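(* Let the number of queries $m=m(r)$ and the number of models $n=n(r)$ satisfy $m,n\to\infty$ as the number of replicates $r\to\infty$. Let $\mathcal{M}\subset\mathbb{R}^q$ be a compact Riemannian manifold, and assume that for every model $f_i$ there exists a vector $\boldsymbol{\phi}_i\in\mathcal{M}$ such that for all pairs $(i,i')\in\mathbb{N}\times\mathbb{N}$, $\frac{1}{m}\lVert\boldsymbol{\mu}_i-\boldsymbol{\mu}_{i'}\rVert_F\to\lVert\boldsymbol{\phi}_i-\boldsymbol{\phi}_{i'}\rVert$ as $r\to\infty$. Define $\boldsymbol{\Delta}^{(\infty)}(\boldsymbol{\phi}_i,\boldsymbol{\phi}_{i'})=\lVert\boldsymbol{\phi}_i-\boldsymbol{\phi}_{i'}\rVert$. Let $\boldsymbol{\Sigma}_{ij}$ be the covariance matrix of the distribution $F_{ij}$ and $\gamma_{ij}=\mathrm{trace}(\boldsymbol{\Sigma}_{ij})$. If $$\lim_{r\to\infty}\frac{\frac{1}{m}\sum_{j=1}^m\gamma_{ij}}{r}=0\quad\text{for all } i,$$ then for every pair $(i,i')\in\mathbb{N}\times\mathbb{N}$, $\left|\mathbf{D}_{ii'}-\boldsymbol{\Delta}^{(\infty)}(\boldsymbol{\phi}_i,\boldsymbol{\phi}_{i'})\right|\to 0$ in probability as $r\to\infty$.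
   Context: $\lVert\cdot\rVert$ is the Euclidean norm and $\lVert\cdot\rVert_F$ the Frobenius norm. There are generative models $f_1,f_2,\dots$ (random maps from a query space $\mathcal{Q}$ to an output space $\mathcal{X}$), of which the first $n$ are used, and queries $q_1,q_2,\dots\in\mathcal{Q}$, of which the first $m$ are used. Each model $f_i$ responds to each query $q_j$ exactly $r$ times; the $k$-th response is $f_i(q_j)_k$. An embedding function $g:\mathcal{X}\to\mathbb{R}^s$ maps responses to vectors, and for each $i,j$ the vectors $g(f_i(q_j)_k)$, $k=1,\dots,r$, are i.i.d. with distribution $F_{ij}$ on $\mathbb{R}^s$, which has a mean and a covariance matrix. $\bar{\mathbf{X}}_i\in\mathbb{R}^{m\times s}$ is the matrix whose $j$-th row is $\frac{1}{r}\sum_{k=1}^r g(f_i(q_j)_k)$, and $\boldsymbol{\mu}_i\in\mathbb{R}^{m\times s}$ is the matrix whose $j$-th row is the mean of $F_{ij}$. $\mathbf{D}\in\mathbb{R}^{n\times n}$ is the random matrix with entries $\mathbf{D}_{ii'}=\frac{1}{m}\lVert\bar{\mathbf{X}}_i-\bar{\mathbf{X}}_{i'}\rVert_F$. All of these depend on $r$ (and on $m=m(r)$); for a fixed pair $(i,i')$ the entry $\mathbf{D}_{ii'}$ is defined for all $r$ large enough that $n(r)\ge\max(i,i')$. *)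

(* Defs.v *)
From HB Require Import structures.
From mathcomp Require Import all_boot all_order all_algebra.
From mathcomp Require Import all_classical all_reals all_analysis.

Set Implicit Arguments.
Unset Strict Implicit.
Unset Printing Implicit Defensive.

Import Order.TTheory GRing.Theory Num.Theory.
Import numFieldNormedType.Exports.

Local Open Scope classical_set_scope.
Local Open Scope ring_scope.

(* The library norm [`|A|] on matrices is the sup norm, hence these two. *)

Definition frobenius_norm (R : realType) (a b : nat) (A : 'M[R]_(a, b)) : R :=
  Num.sqrt (\sum_(i < a) \sum_(j < b) A i j ^+ 2).

Definition euclidean_norm (R : realType) (n : nat) (x : 'rV[R]_n) : R :=
  Num.sqrt (\sum_(i < n) x 0 i ^+ 2).

(* Entry of a square matrix at natural-number indices; the value 0 out of range
   is a dummy. *)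
Definition mxentry (R : realType) (n : nat) (A : 'M[R]_n) (i j : nat) : R :=
  if insub i is Some a then if insub j is Some b then A a b else 0 else 0.

Section Manifold.
Variables (R : realType) (q : nat).

(* [f] is C^k on the open set [U]: partial derivatives of order at most [k]
   exist and those of order [k] are continuous. *)
Fixpoint Ck_on (p : nat) (V : normedModType R) (k : nat) (U : set 'rV[R]_p)
    (f : 'rV[R]_p -> V) : Prop :=
  match k with
  | 0%N => forall x, U x -> {for x, continuous f}
  | k'.+1 => forall i : 'I_p,
      (forall x, U x -> derivable f x (delta_mx 0 i)) /\
      Ck_on k' U (fun x => 'D_(delta_mx 0 i) f x)
  end.

Definition smooth_on (p : nat) (V : normedModType R) (U : set 'rV[R]_p)
    (f : 'rV[R]_p -> V) : Prop :=
  forall k : nat, Ck_on k U f.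

(* R^d x {0}, as a subset of R^q, and the projection onto it *)
Definition slice (d : nat) : set 'rV[R]_q :=
  [set y | forall i : 'I_q, (d <= i)%N -> y 0 i = 0].

Definition slice_proj (d : nat) (y : 'rV[R]_q) : 'rV[R]_q :=
  \row_(i < q) (if (i < d)%N then y 0 i else 0).

(* [Phi : V -> W] is a diffeomorphism between open subsets of R^q, with inverse
   [Psi], which flattens [M] to [R^d x {0}]. *)
Definition slice_chart (d : nat) (M V W : set 'rV[R]_q)
    (Phi Psi : 'rV[R]_q -> 'rV[R]_q) : Prop :=
  [/\ open V /\ open W,
      smooth_on V Phi /\ smooth_on W Psi,
      Phi @` V = W,
      (forall x, V x -> Psi (Phi x) = x) &
      Phi @` (M `&` V) = W `&` slice d].

Definition submanifold (d : nat) (M : set 'rV[R]_q) : Prop :=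
  (d <= q)%N /\
  forall p, M p -> exists V W Phi Psi, slice_chart d M V W Phi Psi /\ V p.

(* The tangent space of [M] at [p]: the velocities at [p] of curves in [M]. *)
Definition tangent (M : set 'rV[R]_q) (p : 'rV[R]_q) : set 'rV[R]_q :=
  [set v | exists c : R -> 'rV[R]_q,
     [/\ c 0 = p, (\forall t \near (0 : R), M (c t)) &
         is_derive (0 : R) (1 : R) c v]].

(* [h p u v] is only meaningful for [p] in [M] and [u], [v] tangent at [p].
   The last clause says that the coefficients of [h] in the local coordinates
   [y_0, ..., y_(d-1)] given by a slice chart are smooth functions; they are
   composed with [slice_proj], so that smoothness on an open subset of R^d
   becomes smoothness on an open subset of R^q. *)
Definition riemannian_metric (d : nat) (M : set 'rV[R]_q)
    (h : 'rV[R]_q -> 'rV[R]_q -> 'rV[R]_q -> R) : Prop :=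
  [/\ (forall p u v w (a : R), M p ->
         tangent M p u -> tangent M p v -> tangent M p w ->
         h p (a *: u + v) w = a * h p u w + h p v w),
      (forall p u v, M p -> tangent M p u -> tangent M p v ->
         h p u v = h p v u),
      (forall p u, M p -> tangent M p u -> u != 0 -> 0 < h p u u) &
      (forall V W Phi Psi, slice_chart d M V W Phi Psi ->
         forall i j : 'I_q, (i < d)%N -> (j < d)%N ->
         smooth_on (slice_proj d @^-1` W)
           (fun y => let z := slice_proj d y in
              (h (Psi z) ('D_(delta_mx 0 i) Psi z)
                         ('D_(delta_mx 0 j) Psi z) : R^o)))].

Definition compact_riemannian_manifold (d : nat) (M : set 'rV[R]_q)
    (h : 'rV[R]_q -> 'rV[R]_q -> 'rV[R]_q -> R) : Prop :=
  [/\ compact M, submanifold d M & riemannian_metric d M h].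

End Manifold.

(* R^s with its Borel sigma-algebra *)
Notation borel_row R s := (g_sigma_algebraType (@open 'rV[R]_s)).

Section Moments.
Variables (R : realType) (s : nat) (F : probability (borel_row R s) R).

Definition coord (l : 'I_s) (x : borel_row R s) : R := (x : 'rV[R]_s) 0 l.

Definition mean_row : 'rV[R]_s := \row_(l < s) fine 'E_F[coord l].

Definition covariance_mx : 'M[R]_s :=
  \matrix_(a < s, b < s) fine (covariance F (coord a) (coord b)).

Definition has_mean_and_covariance : Prop :=
  (forall l, F.-integrable setT (EFin \o coord l)) /\
  (forall a b, F.-integrable setT
     (fun x => ((coord a x - mean_row 0 a) * (coord b x - mean_row 0 b))%:E)).

End Moments.

Section Probability.
Variables (R : realType) (disp : measure_display) (T : measurableType disp).
Variable P : probability T R.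

Definition mutually_independent (s : nat) (Y : nat -> T -> borel_row R s) :
    Prop :=
  forall (J : seq nat) (A : nat -> set (borel_row R s)),
    uniq J -> (forall k, measurable (A k)) ->
    P (\bigcap_(k in [set` J]) (Y k @^-1` A k)) =
    (\prod_(k <- J) P (Y k @^-1` A k))%E.

Definition iid_with_distribution (s : nat) (Y : nat -> T -> borel_row R s)
    (F : probability (borel_row R s) R) : Prop :=
  [/\ (forall k, measurable_fun setT (Y k)),
      (forall k A, measurable A -> pushforward P (Y k) A = F A) &
      mutually_independent Y].

Definition cvg_in_probability (Z : nat -> T -> R) (L : T -> R) : Prop :=
  forall eps : R, 0 < eps ->
    (fun r => P [set w | eps < `|Z r w - L w|]) @ \oo --> 0%E.

End Probability.

Section Model.
Variables (R : realType) (T Q X : Type) (s : nat).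
(* [f i x k w] is the [k]-th response of model [i] to the query [x], at the
   outcome [w].  Models, queries and replicates are numbered from 0. *)
Variables (f : nat -> Q -> nat -> T -> X) (query : nat -> Q).
Variable g : X -> 'rV[R]_s.

Definition embedded (i j k : nat) (w : T) : 'rV[R]_s := g (f i (query j) k w).

Definition Xbar (m r i : nat) (w : T) : 'M[R]_(m, s) :=
  \matrix_(j < m) (r%:R^-1 *: \sum_(k < r) embedded i j k w).

Definition mu_mx (F : nat -> nat -> probability (borel_row R s) R)
    (m i : nat) : 'M[R]_(m, s) :=
  \matrix_(j < m) mean_row (F i j).

Definition Dmx (n m r : nat) (w : T) : 'M[R]_n :=
  \matrix_(i < n, i' < n)
    (m%:R^-1 * frobenius_norm (Xbar m r i w - Xbar m r i' w)).

End Model.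

(* Main.v *)
(* By the reverse triangle inequality for the Frobenius norm,
   |D_ii' - m^-1 |mu_i - mu_i'|_F| is at most
   m^-1 |Xbar_i - mu_i|_F + m^-1 |Xbar_i' - mu_i'|_F.  The replicates being
   pairwise uncorrelated, E |Xbar_i - mu_i|_F^2 = (sum_j gamma_ij) / r, so
   Markov's inequality bounds P(m^-1 |Xbar_i - mu_i|_F > eps) by
   eps^-2 m^-1 (sum_j gamma_ij) / r, which tends to 0. *)
Require Import Defs.
From HB Require Import structures.
From mathcomp Require Import all_boot all_order all_algebra.
From mathcomp Require Import all_classical all_reals all_analysis.
From mathcomp Require Import measurable_realfun ring.

Set Implicit Arguments.
Unset Strict Implicit.
Unset Printing Implicit Defensive.

Import Order.TTheory GRing.Theory Num.Theory.
Import numFieldNormedType.Exports.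

Local Open Scope classical_set_scope.
Local Open Scope ring_scope.

(** * Cauchy-Schwarz and triangle inequalities for the Frobenius norm *)

Lemma sum_mul_le_sqrt (R : realType) (I : finType) (u v : I -> R) :
  \sum_i u i * v i <= Num.sqrt (\sum_i u i ^+ 2) * Num.sqrt (\sum_i v i ^+ 2).
Proof.
set U := \sum_i u i ^+ 2; set V := \sum_i v i ^+ 2.
have U0 : 0 <= U by apply: sumr_ge0 => i _; exact: sqr_ge0.
have V0 : 0 <= V by apply: sumr_ge0 => i _; exact: sqr_ge0.
have zero (w : I -> R) : \sum_i w i ^+ 2 = 0 -> forall i, w i = 0.
  move=> w0 i; apply/eqP; rewrite -sqrf_eq0; apply/eqP.
  by apply: (psumr_eq0P _ w0) => // j _; exact: sqr_ge0.
have [/zero u0|Un0] := eqVneq U 0.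
  by rewrite big1 ?mulr_ge0 ?sqrtr_ge0// => i _; rewrite u0 mul0r.
have [/zero v0|Vn0] := eqVneq V 0.
  by rewrite big1 ?mulr_ge0 ?sqrtr_ge0// => i _; rewrite v0 mulr0.
set a := Num.sqrt U; set b := Num.sqrt V.
have ab0 : 0 < a * b by rewrite mulr_gt0 ?sqrtr_gt0 ?lt_def ?Un0 ?Vn0.
(* Since [a ^+ 2 = U] and [b ^+ 2 = V], this sum expands to [2 a b (a b - \sum_i u i * v i)].
   Dividing by [2 a b] gives the bound, which is why the cases [U = 0] and [V = 0] are settled
   first. *)
have : 0 <= \sum_i (b * u i - a * v i) ^+ 2.
  by apply: sumr_ge0 => i _; exact: sqr_ge0.
rewrite (eq_bigr (fun i => b ^+ 2 * u i ^+ 2 + a ^+ 2 * v i ^+ 2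
    - (a * b *+ 2) * (u i * v i))); last by move=> i _; ring.
rewrite sumrB big_split/= -!mulr_sumr -/U -/V !sqr_sqrtr//.
rewrite (_ : V * U + U * V = (a * b *+ 2) * (a * b)).
  by rewrite -mulrBr pmulr_rge0 ?mulrn_wgt0// subr_ge0.
rewrite -(sqr_sqrtr U0) -(sqr_sqrtr V0) -/a -/b; ring.
Qed.

(** A single sum over index pairs turns the matrix into one vector, the form in which Cauchy-Schwarz
    applies. *)
Lemma frobenius_normE (R : realType) (a b : nat) (A : 'M[R]_(a, b)) :
  frobenius_norm A = Num.sqrt (\sum_(p : 'I_a * 'I_b) A p.1 p.2 ^+ 2).
Proof. by rewrite /frobenius_norm pair_bigA. Qed.

(** After squaring both sides only the cross terms differ, and these are compared by
    Cauchy-Schwarz. *)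
Lemma ler_frobenius_normD (R : realType) (a b : nat) (A B : 'M[R]_(a, b)) :
  frobenius_norm (A + B) <= frobenius_norm A + frobenius_norm B.
Proof.
rewrite !frobenius_normE -[leRHS]ger0_norm ?addr_ge0 ?sqrtr_ge0//.
rewrite -sqrtr_sqr ler_sqrt ?sqr_ge0//.
under eq_bigr do rewrite mxE sqrrD.
rewrite !big_split/= sqrrD !sqr_sqrtr; last 2 first.
- by apply: sumr_ge0 => i _; exact: sqr_ge0.
- by apply: sumr_ge0 => i _; exact: sqr_ge0.
by rewrite lerD2r lerD2l mulr2n lerD// sum_mul_le_sqrt.
Qed.

Lemma frobenius_normN (R : realType) (a b : nat) (A : 'M[R]_(a, b)) :
  frobenius_norm (- A) = frobenius_norm A.
Proof.
rewrite !frobenius_normE; congr Num.sqrt.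
by apply: eq_bigr => i _; rewrite mxE sqrrN.
Qed.

(** The reverse triangle inequality is applied to [A - A'] and [B - B'], whose difference regroups
    as [(A - B) - (A' - B')]. The one-sided bound [e] is used twice, the second time with the two
    pairs exchanged. *)
Lemma frobenius_norm_distB (R : realType) (a b : nat) (A A' B B' : 'M[R]_(a, b)) :
  `|frobenius_norm (A - A') - frobenius_norm (B - B')| <=
  frobenius_norm (A - B) + frobenius_norm (A' - B').
Proof.
have h (U V : 'M[R]_(a, b)) :
    frobenius_norm U - frobenius_norm V <= frobenius_norm (U - V).
  by rewrite lerBlDr -{1}(subrK V U) ler_frobenius_normD.
have e (U U' V V' : 'M[R]_(a, b)) :
    frobenius_norm (U - U') - frobenius_norm (V - V') <=
    frobenius_norm (U - V) + frobenius_norm (U' - V').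
  apply: (le_trans (h _ _)).
  rewrite -[U' - V']opprB frobenius_normN.
  rewrite (_ : _ - (V - V') = (U - V) + (V' - U')) ?ler_frobenius_normD//.
  by rewrite opprB addrACA [RHS]addrACA [- U' - V]addrC.
rewrite ler_norml e andbT lerNl opprB (le_trans (e _ _ _ _))//.
by rewrite -[B - A]opprB -[B' - A']opprB !frobenius_normN.
Qed.

(** * Expectation of a product of two independent integrable variables *)

Section IndependentProduct.
Context (R : realType) (d : measure_display) (T : measurableType d).
Variable P : probability T R.
Variables X Y : {RV P >-> R}.
Hypothesis indepXY : forall A B : set R, measurable A -> measurable B ->
  P (X @^-1` A `&` Y @^-1` B) = (P (X @^-1` A) * P (Y @^-1` B))%E.

Let XY (w : T) : R * R := (X w, Y w).

Let mXY : measurable_fun setT XY.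
Proof. exact: measurable_fun_pair. Qed.

HB.instance Definition _ := isMeasurableFun.Build _ _ _ _ XY mXY.

(** Independence says that the joint law and the product of the marginal laws agree on rectangles;
    uniqueness of the product measure extends this to all measurable sets. *)
Let law_XY (A : set (R * R)) : measurable A ->
  (distribution P X \x distribution P Y)%E A = distribution P XY A.
Proof.
move=> mA; apply: product_measure_unique => // B C mB mC; exact: indepXY.
Qed.

Let prod_fun (z : R * R) : \bar R := (z.1 * z.2)%:E.

Let mprod : measurable_fun setT prod_fun.
Proof.
by apply/measurable_EFinP; apply: measurable_funM.
Qed.

Hypothesis iX : P.-integrable setT (EFin \o X).
Hypothesis iY : P.-integrable setT (EFin \o Y).

Let iXl : (distribution P X).-integrable setT EFin.
Proof. by apply: integrable_pushforward => //; exact: EFin_measurable. Qed.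

Let iYl : (distribution P Y).-integrable setT EFin.
Proof. by apply: integrable_pushforward => //; exact: EFin_measurable. Qed.

(** By Tonelli, the integral of [|x y|] factors into [E|X|] times [E|Y|], both finite. *)
Let iprod : (distribution P X \x distribution P Y)%E.-integrable setT prod_fun.
Proof.
apply/integrable12ltyP => //=.
have mnorm : measurable_fun setT (fun x : R => `|x|%:E).
  by apply/measurable_EFinP; exact: normr_measurable.
under eq_integral => x _.
  under eq_integral do rewrite normrM EFinM.
  rewrite ge0_integralZl//.
  over.
rewrite /= ge0_integralZr//; last exact: integral_ge0.
move/integrableP : iXl => [_ /= lX]; move/integrableP : iYl => [_ /= lY].
by rewrite lte_mul_pinfty// ?integral_ge0// ge0_fin_numE// integral_ge0.
Qed.

Lemma integrable_mul_indep : P.-integrable setT (fun w => (X w * Y w)%:E).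
Proof.
apply/integrableP; split; first exact/measurable_EFinP/measurable_funM.
move/integrableP : iprod => [_].
rewrite (@eq_measure_integral _ _ _ _ (distribution P XY)); last first.
  by move=> A mA _; exact: law_XY.
by rewrite ge0_integral_distribution//; exact: measurableT_comp.
Qed.

(** The expectation is moved to the product law, where Fubini makes it an iterated integral; the
    inner integral contributes the constant factor [E Y]. *)
Lemma integral_mul_indep :
  (\int[P]_w (X w * Y w)%:E = (\int[P]_w (X w)%:E) * \int[P]_w (Y w)%:E)%E.
Proof.
transitivity (\int[distribution P X \x distribution P Y]_z prod_fun z)%E.
  rewrite (@eq_measure_integral _ _ _ _ (distribution P XY)); last first.
    by move=> A mA _; exact: law_XY.
  by rewrite integral_distribution//; exact: integrable_mul_indep.
rewrite -integral12_prod_meas1// /fubini_F /prod_fun/=.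
have EY : (\int[distribution P Y]_y y%:E = \int[P]_w (Y w)%:E)%E.
  by rewrite integral_distribution//; exact: EFin_measurable.
have EX : (\int[distribution P X]_y y%:E = \int[P]_w (X w)%:E)%E.
  by rewrite integral_distribution//; exact: EFin_measurable.
under eq_integral => x _.
  under eq_integral do rewrite EFinM.
  rewrite integralZl// EY.
  over.
(* The constant to be pulled out of the integral must be a real number, so finiteness of [E Y] is
   needed here. *)
have /fineK <- : (\int[P]_w (Y w)%:E)%E \is a fin_num by exact: integrable_fin_num.
by rewrite integralZr// EX.
Qed.

End IndependentProduct.

(** * Second moment of a sum of uncorrelated variables *)

Section Uncorrelated.
Context (R : realType) (d : measure_display) (T : measurableType d).
Variables (P : probability T R) (W : nat -> T -> R) (v : R).
Hypothesis iW : forall k l, P.-integrable setT (fun w => (W k w * W l w)%:E).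
Hypothesis W0 : forall k l, k != l -> (\int[P]_w (W k w * W l w)%:E = 0)%E.
Hypothesis Wv : forall k, (\int[P]_w (W k w * W k w)%:E = v%:E)%E.

Let sqr_sumE r w : ((\sum_(k < r) W k w) ^+ 2)%:E =
  (\sum_(p : 'I_r * 'I_r) (W p.1 w * W p.2 w)%:E)%E.
Proof.
rewrite expr2 big_distrlr/= sumEFin; congr EFin.
by rewrite (pair_bigA _ (fun k l : 'I_r => W k w * W l w)).
Qed.

(** In the expanded square the off-diagonal terms integrate to 0, and each of the [r] diagonal terms
    contributes [v]. *)
Lemma integral_sqr_sum_uncorrelated r :
  (\int[P]_w ((\sum_(k < r) W k w) ^+ 2)%:E = (v *+ r)%:E)%E.
Proof.
under eq_integral do rewrite sqr_sumE.
rewrite integral_sum//.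
rewrite -(pair_bigA _ (fun k l : 'I_r => \int[P]_w (W k w * W l w)%:E)%E)/=.
under eq_bigr => k _.
  rewrite (bigD1 k)//= big1; last first.
    by move=> l lk; rewrite W0// eq_sym.
  rewrite Wv adde0; over.
by rewrite sumEFin sumr_const card_ord.
Qed.

End Uncorrelated.

(** * Mean squared error of the average of i.i.d. vectors, one coordinate at a time *)

Lemma measurable_coord (R : realType) (s : nat) (l : 'I_s) :
  measurable_fun setT (@Defs.coord R s l).
Proof.
(* It suffices to test open intervals; their preimages are open because coordinates are
   continuous. *)
apply: (measurability _ (RGenOpens.measurableE R)).
move=> _ [_ [a [b ->] <-]].
rewrite setTI; apply: sub_sigma_algebra.
have /continuousP := @coord_continuous R 1 s 0 l; apply.
exact: interval_open.
Qed.

Section Iid.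
Context (R : realType) (d : measure_display) (T : measurableType d) (s : nat).
Variables (P : probability T R) (Y : nat -> T -> borel_row R s).
Variable F : probability (borel_row R s) R.
Hypothesis iidY : iid_with_distribution P Y F.
Hypothesis momF : has_mean_and_covariance F.

Let mY k : measurable_fun setT (Y k).
Proof. by case: iidY. Qed.

(** The law of [Y k] is known to agree with [F] only on measurable sets, which is enough to identify
    integrals. *)
Let lawY k (f : borel_row R s -> \bar R) :
  (\int[pushforward P (Y k)]_x f x = \int[F]_x f x)%E.
Proof. by apply: eq_measure_integral => A mA _; case: iidY => _ h _; exact: h. Qed.

Let integrable_law k (f : borel_row R s -> \bar R) :
  F.-integrable setT f -> P.-integrable setT (f \o Y k).
Proof.
move=> /integrableP[mf lf]; apply/integrableP; split.
  exact: measurableT_comp.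
move: lf; rewrite -(lawY k) ge0_integral_pushforward//.
exact: measurableT_comp.
Qed.

Let integral_law k (f : borel_row R s -> \bar R) :
  F.-integrable setT f -> (\int[P]_w f (Y k w) = \int[F]_x f x)%E.
Proof.
move=> fi; rewrite -(lawY k) integral_pushforward//.
- exact: measurable_int fi.
- exact: integrable_law.
Qed.

Variable l : 'I_s.

(** Centering a fixed coordinate reduces the vector case to real variables of mean 0, for which
    independence gives zero correlation. *)
Let ctr (x : borel_row R s) : R := Defs.coord l x - mean_row F 0 l.

Let mctr : measurable_fun setT ctr.
Proof. by apply: measurable_funB => //; exact: measurable_coord. Qed.

Let ictr : F.-integrable setT (EFin \o ctr).
Proof.
have [il _] := momF.
apply: (eq_integrable _ ((EFin \o Defs.coord l) \- cst (mean_row F 0 l)%:E)%E) => //.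
by apply: integrableB => //; exact: finite_measure_integrable_cst.
Qed.

Let ctr0 : (\int[F]_x (ctr x)%:E = 0)%E.
Proof.
have [il _] := momF.
under eq_integral do rewrite EFinB.
rewrite integralB//; [|exact: il|exact: finite_measure_integrable_cst].
rewrite integral_cst// [X in (_ * X)%E](_ : _ = 1%E) ?mule1; last first.
  exact: probability_setT.
have fE := integrable_fin_num measurableT (il l).
by rewrite mxE unlock fineK// subee.
Qed.

Let W k w := ctr (Y k w).

Let mW k : measurable_fun setT (W k).
Proof. exact: measurableT_comp. Qed.

HB.instance Definition _ k := isMeasurableFun.Build _ _ _ _ (W k) (mW k).

Let iW1 k : P.-integrable setT (EFin \o W k).
Proof. exact: (integrable_law k ictr). Qed.

Let EW k : (\int[P]_w (W k w)%:E = 0)%E.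
Proof. by rewrite -ctr0 -(integral_law k ictr). Qed.

Let indepW k k' : k != k' -> forall A B : set R, measurable A -> measurable B ->
  P (W k @^-1` A `&` W k' @^-1` B) = (P (W k @^-1` A) * P (W k' @^-1` B))%E.
Proof.
move=> kk' A B mA mB; have [_ _ mi] := iidY.
have mc C : measurable C -> measurable (ctr @^-1` C).
  by move=> mC; rewrite -[X in measurable X]setTI; exact: mctr.
(* Mutual independence is specialised to two indices; the family of events is [A] at [k] and [B] at
   every other index, in particular at [k']. *)
have := mi [:: k; k'] (fun j => ctr @^-1` (if j == k then A else B)).
rewrite /= inE kk' /= !big_cons big_nil mule1 eqxx eq_sym (negbTE kk').
move=> <- //; last by move=> j; case: ifP => _; exact: mc.
congr (P _); apply/seteqP; split => [w [Aw Bw] j /=|w h].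
  by rewrite !inE => /orP[]/eqP->; rewrite ?eqxx// eq_sym (negbTE kk').
split; first by have := h k; rewrite /= !inE eqxx; apply.
by have := h k'; rewrite /= !inE eqxx orbT eq_sym (negbTE kk'); apply.
Qed.

Let ctr_sqr : F.-integrable setT (fun x => (ctr x * ctr x)%:E).
Proof. by have [_ ] := momF; apply. Qed.

Let Ectr_sqr : (\int[F]_x (ctr x * ctr x)%:E = (covariance_mx F l l)%:E)%E.
Proof.
have fE := integrable_fin_num measurableT ctr_sqr.
rewrite mxE (_ : covariance F _ _ = \int[F]_x (ctr x * ctr x)%:E)%E ?fineK//.
rewrite unlock [in LHS]unlock; apply: eq_integral => x _.
by rewrite /ctr mxE unlock.
Qed.

(** On the diagonal this is the second-moment assumption on [F]; off the diagonal it comes from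
    independence and first moments. *)
Let iW k k' : P.-integrable setT (fun w => (W k w * W k' w)%:E).
Proof.
have [->|kk'] := eqVneq k k'; first exact: (integrable_law k' ctr_sqr).
exact: (integrable_mul_indep (indepW kk') (iW1 k) (iW1 k')).
Qed.

Lemma integral_sqr_sample_mean r : (0 < r)%N ->
  (\int[P]_w ((r%:R^-1 * (\sum_(k < r) Defs.coord l (Y k w)) - mean_row F 0 l) ^+ 2)%:E
   = (covariance_mx F l l / r%:R)%:E)%E.
Proof.
move=> r0; have rn0 : r%:R != 0 :> R by rewrite pnatr_eq0 -lt0n.
(* The error of the average is [1/r] times the sum of the centered replicates. The second moment of
   that sum is [r] times the variance, so the factor [r ^- 2] leaves variance over [r]. *)
transitivity (\int[P]_w ((r%:R ^- 2)%:E * ((\sum_(k < r) W k w) ^+ 2)%:E))%E.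
  apply: eq_integral => w _; rewrite -EFinM -exprVn -exprMn; congr (_ ^+ 2)%:E.
  by rewrite sumrB sumr_const card_ord mulrBr -(mulr_natl (mean_row F 0 l)) mulKf.
rewrite ge0_integralZl//; last 2 first.
- apply/measurable_EFinP/measurable_funX/measurable_sum => k; exact: mW.
- by move=> w _; rewrite lee_fin sqr_ge0.
rewrite (@integral_sqr_sum_uncorrelated _ _ _ P W (covariance_mx F l l))//.
- by rewrite -EFinM -mulr_natr; congr EFin; field.
- move=> k k' kk'.
  by rewrite (integral_mul_indep (indepW kk') (iW1 k) (iW1 k')) EW mul0e.
- by move=> k; rewrite (integral_law k ctr_sqr) Ectr_sqr.
Qed.

End Iid.

(** * Deviation of the matrix of sample means from the matrix of means *)

Lemma measurable_frobenius_norm (R : realType) (d : measure_display)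
    (T : measurableType d) (a b : nat) (A : T -> 'M[R]_(a, b)) :
  (forall i j, measurable_fun setT (fun w => A w i j)) ->
  measurable_fun setT (fun w => frobenius_norm (A w)).
Proof.
move=> mA; have msqrt := continuous_measurable_fun (@sqrt_continuous R).
apply: (measurableT_comp msqrt).
by apply: measurable_sum => i; apply: measurable_sum => j; exact: measurable_funX.
Qed.

Section SampleMeans.
Context (R : realType) (disp : measure_display) (T : measurableType disp).
Context (Q X : Type) (s : nat).
Variables (P : probability T R) (f : nat -> Q -> nat -> T -> X).
Variables (query : nat -> Q) (g : X -> 'rV[R]_s).
Variable F : nat -> nat -> probability (borel_row R s) R.
Hypothesis hiid : forall i j,
  iid_with_distribution P (embedded f query g i j) (F i j).
Hypothesis hmom : forall i j, has_mean_and_covariance (F i j).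

Local Notation dev m r i w :=
  (frobenius_norm (Xbar f query g m r i w - mu_mx F m i)).

Let XbarE m r i w (j : 'I_m) (l : 'I_s) : Xbar f query g m r i w j l =
  r%:R^-1 * \sum_(k < r) Defs.coord l (embedded f query g i j k w).
Proof. by rewrite !mxE summxE. Qed.

Let measurable_Xbar m r i (j : 'I_m) (l : 'I_s) :
  measurable_fun setT (fun w => Xbar f query g m r i w j l).
Proof.
rewrite (_ : (fun w => _) = (fun w => r%:R^-1 *
    \sum_(k < r) Defs.coord l (embedded f query g i j k w))); last first.
  by apply/funext => w; exact: XbarE.
apply: measurable_funM => //; apply: measurable_sum => k.
have [mY _ _] := hiid i j.
exact: (measurableT_comp (@measurable_coord R s l) (mY k)).
Qed.

Lemma measurable_sample_mean_dev m r i : measurable_fun setT (fun w => dev m r i w).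
Proof.
apply: measurable_frobenius_norm => j l.
under eq_fun do rewrite mxE; exact: measurable_funD.
Qed.

Lemma measurable_frobenius_norm_XbarB m r i i' : measurable_fun setT
  (fun w => frobenius_norm (Xbar f query g m r i w - Xbar f query g m r i' w)).
Proof.
apply: measurable_frobenius_norm => j l.
under eq_fun do rewrite mxE [X in _ + X]mxE; exact: measurable_funB.
Qed.

(** The squared norm is a sum of nonnegative entrywise errors, integrated term by term; summing the
    variances over the coordinates of row [j] gives the trace of its covariance matrix. *)
Lemma integral_sample_mean_dev_sqr m r i : (0 < r)%N ->
  (\int[P]_w (dev m r i w ^+ 2)%:E =
   ((\sum_(j < m) \tr (covariance_mx (F i j))) / r%:R)%:E)%E.
Proof.
move=> r0.
have sq w : (dev m r i w ^+ 2)%:E =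
    (\sum_(p : 'I_m * 'I_s) ((r%:R^-1 *
      (\sum_(k < r) Defs.coord p.2 (embedded f query g i p.1 k w))
      - mean_row (F i p.1) 0 p.2) ^+ 2)%:E)%E.
  rewrite frobenius_normE sqr_sqrtr; last first.
    by apply: sumr_ge0 => p _; exact: sqr_ge0.
  rewrite sumEFin; congr EFin; apply: eq_bigr => -[j l] _ /=.
  by rewrite !mxE summxE.
under eq_integral do rewrite sq.
rewrite ge0_integral_sum//; last 2 first.
- move=> [j l]; apply/measurable_EFinP/measurable_funX/measurable_funB => //=.
  by have := @measurable_Xbar m r i j l; under eq_fun do rewrite XbarE.
- by move=> p w _; rewrite lee_fin sqr_ge0.
under eq_bigr do rewrite (integral_sqr_sample_mean (hiid _ _) (hmom _ _))//.
by rewrite sumEFin -mulr_suml -(pair_bigA _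
  (fun (j : 'I_m) (l : 'I_s) => covariance_mx (F i j) l l)).
Qed.

Lemma prob_sample_mean_dev_gt m r i (eps : R) : (0 < r)%N -> (0 < m)%N -> 0 < eps ->
  (P [set w | (eps < m%:R^-1 * dev m r i w)%R] <=
   (eps ^- 2 * (m%:R^-1 * (\sum_(j < m) \tr (covariance_mx (F i j))) / r%:R))%:E)%E.
Proof.
move=> r0 m0 eps0.
have mR : 0 < m%:R :> R by rewrite ltr0n.
set S := \sum_(j < m) _; set A := [set w | _].
have dev0 w : 0 <= dev m r i w ^+ 2 by exact: sqr_ge0.
(* Nonnegativity of the traces is read off from the integral of a square. *)
have S0 : 0 <= S / r%:R.
  rewrite -lee_fin -integral_sample_mean_dev_sqr//.
  by apply: integral_ge0 => w _; rewrite lee_fin.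
have mS : measurable_fun setT (fun w => (dev m r i w ^+ 2)%:E).
  by apply/measurable_EFinP/measurable_funX; exact: measurable_sample_mean_dev.
have e2 : 0 < (m%:R * eps) ^+ 2 by rewrite exprn_gt0// mulr_gt0.
have mA : measurable A.
  have mmd : measurable_fun setT (fun w => m%:R^-1 * dev m r i w).
    by apply: measurable_funM => //; exact: measurable_sample_mean_dev.
  rewrite (_ : A = setT `&` (fun w => m%:R^-1 * dev m r i w) @^-1` `]eps, +oo[).
    by apply: mmd => //; exact: measurable_itv.
  by rewrite setTI; apply/seteqP; split => w /=; rewrite in_itv/= andbT.
(* Markov's inequality for the squared deviation at level [(m eps)^2]; the strict event [A] lies
   inside the non-strict one that it bounds. *)
have Markov : (((m%:R * eps) ^+ 2)%:E * P A <= (S / r%:R)%:E)%E.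
  rewrite -integral_sample_mean_dev_sqr//.
  have := le_integral_comp_abse P measurableT (@measurable_id _ _ setT)
    (fun r0 h => h) (fun x y _ _ h => h) mS e2.
  rewrite setTI/=; under eq_integral do rewrite ger0_norm//.
  apply: le_trans; apply: lee_wpmul2l; first by rewrite lee_fin ltW.
  apply: le_measure; rewrite ?inE//.
    rewrite -[X in measurable X]setTI; apply: emeasurable_fun_c_infty => //.
    by under eq_fun do rewrite ger0_norm//.
  move=> w /= Aw; rewrite lee_fin ger0_norm//.
  rewrite ler_pXn2r ?nnegrE ?sqrtr_ge0 ?(ltW (mulr_gt0 _ _))//.
  by rewrite mulrC -ler_pdivlMr// mulrC ltW.
rewrite -lee_pdivlMl// in Markov.
apply: (le_trans Markov); rewrite -EFinM lee_fin.
(* [m^-2] is weakened to [m^-1], to match the hypothesis on the covariances. *)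
rewrite exprMn invfM -!mulrA mulrCA ler_wpM2l ?invr_ge0 ?exprn_ge0 ?(ltW eps0)//.
rewrite ler_wpM2r// lef_pV2 ?posrE ?exprn_gt0//.
by rewrite expr2 ler_peMl ?ler1n// ltW.
Qed.

End SampleMeans.

(** * Convergence in probability of the entries of the distance matrix *)

Theorem theorem4 (R : realType)
    (disp : measure_display) (T : measurableType disp) (P : probability T R)
    (Q X : Type) (s q d : nat)
    (f : nat -> Q -> nat -> T -> X) (query : nat -> Q) (g : X -> 'rV[R]_s)
    (F : nat -> nat -> probability (borel_row R s) R)
    (hiid : forall i j : nat,
       iid_with_distribution P (embedded f query g i j) (F i j))
    (hmom : forall i j : nat, has_mean_and_covariance (F i j))
    (m n : nat -> nat)
    (hm : m @ \oo --> \oo) (hn : n @ \oo --> \oo)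
    (M : set 'rV[R]_q) (h : 'rV[R]_q -> 'rV[R]_q -> 'rV[R]_q -> R)
    (hM : compact_riemannian_manifold d M h)
    (phi : nat -> 'rV[R]_q) (hphiM : forall i : nat, M (phi i))
    (hphi : forall i i' : nat,
       (fun r => (m r)%:R^-1 * frobenius_norm (mu_mx F (m r) i - mu_mx F (m r) i'))
         @ \oo --> euclidean_norm (phi i - phi i'))
    (hgamma : forall i : nat,
       (fun r => ((m r)%:R^-1 * \sum_(j < m r) \tr (covariance_mx (F i j))) / r%:R)
         @ \oo --> (0 : R)) :
  forall i i' : nat,
    cvg_in_probability P
      (fun r w => `|mxentry (Dmx f query g (n r) (m r) r w) i i'
                    - euclidean_norm (phi i - phi i')|)
      (cst 0).
Proof.
move=> i i' eps eps0.
set Delta := euclidean_norm _.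
(* One third of [eps] goes to the sampling error of each of the two models, and one third to the
   convergence of the mean distances to [Delta]. *)
have e3 : 0 < eps / 3 by rewrite divr_gt0.
pose gam k r := (m r)%:R^-1 * (\sum_(j < m r) \tr (covariance_mx (F k j))) / r%:R.
(* The probability is squeezed between 0 and the sum of the two Markov bounds at level [eps / 3]. *)
apply: (@squeeze_cvge _ _ _ _ (cst 0%E) _
    (fun r => ((eps / 3) ^- 2 * gam i r + (eps / 3) ^- 2 * gam i' r)%:E)); last 2 first.
- exact: cvg_cst.
- apply: cvg_EFin; first by near=> r.
  rewrite -[X in _ --> X](addr0 0) -{1 2}(mulr0 ((eps / 3) ^- 2)).
  by apply: cvgD; apply: cvgM; [exact: cvg_cst|exact: hgamma|
    exact: cvg_cst|exact: hgamma].
have hphi3 : \forall r \near \oo, `|Delta - (m r)%:R^-1 *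
    frobenius_norm (mu_mx F (m r) i - mu_mx F (m r) i')| < eps / 3.
  by move/cvgrPdist_lt : (hphi i i') => /(_ _ e3).
near=> r.
have r0 : (0 < r)%N by near: r; exists 1%N.
have m0 : (0 < m r)%N.
  by near: r; exact: (hm _ (nbhs_infty_gt 0%N)).
(* Once both indices are in range, [mxentry] returns the actual entry and not its default 0. *)
have ni : (i < n r)%N by near: r; exact: (hn _ (nbhs_infty_gt i)).
have ni' : (i' < n r)%N by near: r; exact: (hn _ (nbhs_infty_gt i')).
have hr : `|Delta - (m r)%:R^-1 *
    frobenius_norm (mu_mx F (m r) i - mu_mx F (m r) i')| < eps / 3 by near: r.
apply/andP; split; first exact: measure_ge0.
set D := fun w => (m r)%:R^-1 * frobenius_norm
  (Xbar f query g (m r) r i w - Xbar f query g (m r) r i' w).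
have -> : [set w | eps < `| `|mxentry (Dmx f query g (n r) (m r) r w) i i' - Delta|
    - cst 0 w|] = [set w | eps < `|D w - Delta|].
  apply/seteqP; split => w /=;
    by rewrite /mxentry !insubT/= mxE subr0 normr_id.
pose A k := [set w | eps / 3 < (m r)%:R^-1 *
  frobenius_norm (Xbar f query g (m r) r k w - mu_mx F (m r) k)].
have lt_measurable (h0 : T -> R) (a : R) : measurable_fun setT h0 ->
    measurable [set w | a < h0 w].
  move=> mh; rewrite (_ : [set w | _] = setT `&` h0 @^-1` `]a, +oo[).
    by apply: mh => //; exact: measurable_itv.
  by rewrite setTI; apply/seteqP; split => w /=; rewrite in_itv/= andbT.
have mA k : measurable (A k).
  apply: lt_measurable; apply: measurable_funM => //.
  exact: measurable_sample_mean_dev.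
have mD : measurable_fun setT D.
  by apply: measurable_funM => //; exact: measurable_frobenius_norm_XbarB.
(* If neither model deviates by more than [eps / 3], the triangle inequality through the scaled
   distance of the mean matrices gives [|D w - Delta| <= eps]. Hence the bad event lies in [A i] or
   [A i'], and the union bound applies. *)
apply: (@le_trans _ _ (P (A i `|` A i'))).
  apply: le_measure; rewrite ?inE; [|exact: measurableU|].
    apply: lt_measurable; apply: (measurableT_comp (@normr_measurable _ setT)).
    exact: measurable_funB.
  move=> w /= epsD; rewrite /A/=.
  have [|le_i] := ltP (eps / 3) ((m r)%:R^-1 * frobenius_norm
    (Xbar f query g (m r) r i w - mu_mx F (m r) i)); first by left.
  right; rewrite ltNge; apply/negP => le_i'; move: epsD; apply/negP; rewrite -leNgt.
  have dist : `|D w - (m r)%:R^-1 * frobenius_norm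
      (mu_mx F (m r) i - mu_mx F (m r) i')| <= eps / 3 + eps / 3.
    rewrite -mulrBr normrM ger0_norm ?invr_ge0//.
    apply: le_trans (lerD le_i le_i'); rewrite -mulrDr ler_wpM2l ?invr_ge0//.
    exact: frobenius_norm_distB.
  rewrite distrC in hr.
  apply: (le_trans (ler_distD _ _ _)); apply: (le_trans (lerD dist (ltW hr))).
  by rewrite le_eqVlt; apply/orP; left; apply/eqP; field.
apply: (le_trans (measureU2 _ (mA i) (mA i'))).
rewrite EFinD; apply: leeD; exact: prob_sample_mean_dev_gt.
Unshelve. all: by end_near.
Qed.
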